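(* Let $n\ge 3$, let $\Omega\subset\mathbb{R}^n$ be a domain, and let $u=\sum_{i=1}^n u_ie_i$ be a smooth $1$-form and $b=\sum_{j,k=1}^n b_{jk}\,e_j\wedge e_k$ (with $b_{kj}=-b_{jk}$) a smooth $2$-form defined on $\Omega$. Then $$d(u\,\lrcorner\, b)+\delta(u\wedge b)=\delta u\wedge b-u\wedge\delta b-u\,\lrcorner\, db+(\nabla u+\nabla u^\top)\cdot(b-b^\top).$$
   Context: $e_1,\dots,e_n$ is the standard basis of $\mathbb{R}^n$; $\wedge$ is the exterior product on the exterior algebra of $\mathbb{R}^n$, and $\lrcorner$ is the contraction: for vectors, $e_i\lrcorner(e_{j_1}\wedge\dots\wedge e_{j_\ell})=\sum_k(-1)^{k-1}\delta_{i j_k}\,e_{j_1}\wedge\dots\widehat{e_{j_k}}\dots\wedge e_{j_\ell}$, extended linearly (so a $1$-form $u$ can be contracted with any form). $d=\sum_{i=1}^n e_i\wedge\partial_i$ is the exterior derivative and $\delta=-\sum_{i=1}^n e_i\lrcorner\,\partial_i$ the co-derivative (so $\delta u=-\sum_i\partial_iu_i$ for a $1$-form, and $\delta u\wedge b$ is the product of the scalar $\delta u$ with $b$). The $2$-form $b=\sum_{j,k=1}^n b_{jk}e_j\wedge e_k$ (sum over all $j,k$, not only $j<k$) is identified with the antisymmetric $n\times n$ matrix $(b_{jk})$; $\nabla u$ is the matrix $(\partial_iu_j)_{1\le i,j\le n}$; $A\cdot B$ is the matrix product, and an $n\times n$ matrix $A=(A_{ij})$ of functions is regarded as the $2$-form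 $\sum_{i,j=1}^n A_{ij}\,e_i\wedge e_j$. *)

(* Defs.v *)
From mathcomp Require Import all_boot all_order all_algebra.
From mathcomp Require Import all_classical all_reals all_analysis.

Set Implicit Arguments.
Unset Strict Implicit.
Unset Printing Implicit Defensive.

Import Order.TTheory GRing.Theory Num.Theory.
Import numFieldNormedType.Exports.

Local Open Scope ring_scope.

Definition is_domain (T : topologicalType) (Omega : set T) : Prop :=
  [/\ open Omega, connected Omega & Omega !=set0]%classic.

(* A multivector is the family of its coordinates in the basis
   e_S = e_(j_1) /\ ... /\ e_(j_l), where S = {j_1 < ... < j_l}. *)
Notation ext R n := {ffun {set 'I_n} -> R^o}.

Section Exterior.
Variables (R : realType) (n : nat).
Local Notation ext := (ext R n).

Definition ebase (S : {set 'I_n}) : ext := [ffun T => (T == S)%:R].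

Definition inversions (S T : {set 'I_n}) : nat :=
  (\sum_(i in S) \sum_(j in T) (j < i))%N.

Definition ext_wedge_base (S T : {set 'I_n}) : ext :=
  if [disjoint S & T] then (-1) ^+ inversions S T *: ebase (S :|: T) else 0.

Definition ext_wedge (a b : ext) : ext :=
  \sum_S \sum_T (a S * b T) *: ext_wedge_base S T.

(* If j is the k-th smallest element of S (k >= 1), then the exponent of -1
   is k - 1. *)
Definition ext_contraction_base (i : 'I_n) (S : {set 'I_n}) : ext :=
  \sum_(j in S) ((-1) ^+ (\sum_(l in S) (l < j))%N * (i == j)%:R)
                  *: ebase (S :\ j).

Definition ext_contraction (v : 'rV[R]_n) (a : ext) : ext :=
  \sum_i \sum_S (v 0 i * a S) *: ext_contraction_base i S.

Definition evec (i : 'I_n) : ext := ebase [set i].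

Definition form1 (v : 'rV[R]_n) : ext := \sum_i v 0 i *: evec i.

(* The sum runs over all pairs (i, j), so that for an antisymmetric matrix A
   the coordinate on e_i /\ e_j, i < j, is 2 * A i j. *)
Definition form2 (A : 'M[R]_n) : ext :=
  \sum_i \sum_j A i j *: ext_wedge (evec i) (evec j).

(* Differential forms are total functions; on an open set the operators below
   only depend on the values of the form on that set. *)
Definition partial_form (i : 'I_n) (w : 'rV[R]_n -> ext) (x : 'rV[R]_n) : ext :=
  [ffun S => 'D_(delta_mx 0 i) (fun y => w y S : R) x].

Definition ext_deriv (w : 'rV[R]_n -> ext) (x : 'rV[R]_n) : ext :=
  \sum_i ext_wedge (evec i) (partial_form i w x).

Definition coderiv (w : 'rV[R]_n -> ext) (x : 'rV[R]_n) : ext :=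
  - \sum_i ext_contraction (delta_mx 0 i) (partial_form i w x).

Definition gradient (u : 'rV[R]_n -> 'rV[R]_n) (x : 'rV[R]_n) : 'M[R]_n :=
  \matrix_(i, j) 'D_(delta_mx 0 i) (fun y => u y 0 j) x.

Definition iter_partial (s : seq 'I_n) (f : 'rV[R]_n -> R) : 'rV[R]_n -> R :=
  foldr (fun i g x => 'D_(delta_mx 0 i) g x) f s.

(* C^infinity on an open set: all iterated partial derivatives exist and are
   continuous at every point. *)
Definition smooth_on (Omega : set 'rV[R]_n) (f : 'rV[R]_n -> R) : Prop :=
  forall (s : seq 'I_n) (x : 'rV[R]_n), Omega x ->
    {for x, continuous (iter_partial s f)} /\
    forall i : 'I_n, derivable (iter_partial s f) x (delta_mx 0 i).

End Exterior.

(* Main.v *)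
(* Write E_i for the exterior product by e_i and I_j for the contraction by e_j.
   They satisfy the Clifford relation I_j E_i + E_i I_j = delta_ij, and partial
   derivatives act by the Leibniz rule.  Moving every I to the right of every E,
   the terms of the left-hand side containing a derivative of b become
   - u /\ delta b - u _| db, the two copies of sum_i u_i d_i b cancelling, and
   those containing a derivative of u become
   (delta u) b + sum_ij (d_i u_j + d_j u_i) E_i I_j b.
   Finally I_j b is the 1-form given by the j-th row of b - b^T, so that the last
   double sum is the 2-form of the matrix product. *)
Require Import Defs.
From HB Require Import structures.
From mathcomp Require Import all_boot all_order all_algebra.
From mathcomp Require Import all_classical all_reals all_analysis.
From mathcomp Require Import ring.

Set Implicit Arguments.
Unset Strict Implicit.
Unset Printing Implicit Defensive.

Import GRing.Theory numFieldNormedType.Exports.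
Local Open Scope ring_scope.

Lemma is_derive_bigsum (R : numFieldType) (V W : normedModType R) (I : Type)
    (r : seq I) (f : I -> V -> W) (df : I -> W) (x v : V) :
  (forall i, is_derive x v (f i) (df i)) ->
  is_derive x v (fun y => \sum_(i <- r) f i y) (\sum_(i <- r) df i).
Proof.
move=> h; elim: r => [|i r IH].
  rewrite big_nil; under eq_fun do rewrite big_nil; exact: is_derive_cst.
rewrite big_cons; under eq_fun do rewrite big_cons; exact: is_deriveD.
Qed.

Section ExteriorCalculus.
Context {R : realType} {n : nat}.
Implicit Types (i j : 'I_n) (S T : {set 'I_n}) (a b : ext R n) (v : 'rV[R]_n).

(** The cost of moving [e_i] past the elements of [S] smaller than [i]. The same sign arises when
    [e_i] is inserted into [e_S] and when it is removed, which is what makes the Clifford relation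
    come out. *)
Definition insertion_sign i S : R := (-1) ^+ (\sum_(j in S) (j < i))%N.

(** * Bilinearity and reduction to basis multivectors *)

Lemma ext_wedge_linear_r a : linear (ext_wedge a : ext R n -> ext R n).
Proof.
move=> c b b'; rewrite /ext_wedge scaler_sumr -big_split; apply: eq_bigr => S _.
rewrite scaler_sumr -big_split; apply: eq_bigr => T _ /=.
rewrite !ffunE scalerA -scalerDl mulrDr; congr ((_ + _) *: _).
by rewrite mulrCA.
Qed.

Lemma ext_wedge_linear_l b : linear (fun a : ext R n => ext_wedge a b).
Proof.
move=> c a a'; rewrite /ext_wedge scaler_sumr -big_split; apply: eq_bigr => S _.
rewrite scaler_sumr -big_split; apply: eq_bigr => T _ /=.
by rewrite !ffunE scalerA -scalerDl mulrDl mulrA.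
Qed.

Lemma ext_contraction_linear_r v : linear (ext_contraction v : ext R n -> ext R n).
Proof.
move=> c b b'; rewrite /ext_contraction scaler_sumr -big_split; apply: eq_bigr => i _.
rewrite scaler_sumr -big_split; apply: eq_bigr => T _ /=.
rewrite !ffunE scalerA -scalerDl mulrDr; congr ((_ + _) *: _).
by rewrite mulrCA.
Qed.

Lemma ext_contraction_linear_l b : linear (fun v => ext_contraction v b : ext R n).
Proof.
move=> c a a'; rewrite /ext_contraction scaler_sumr -big_split; apply: eq_bigr => S _.
rewrite scaler_sumr -big_split; apply: eq_bigr => T _ /=.
by rewrite !mxE scalerA -scalerDl mulrDl mulrA.
Qed.

HB.instance Definition _ a :=
  GRing.isLinear.Build R (ext R n) (ext R n) *:%R
    (ext_wedge a) (ext_wedge_linear_r a).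
HB.instance Definition _ v :=
  GRing.isLinear.Build R (ext R n) (ext R n) *:%R
    (ext_contraction v) (ext_contraction_linear_r v).

Lemma ext_ebase_sum a : a = \sum_S a S *: ebase R S.
Proof.
apply/ffunP => T; rewrite sum_ffunE (bigD1 T) //= big1 ?addr0 => [|S neq].
  by rewrite !ffunE eqxx [_ *: _]mulr1.
by rewrite !ffunE eq_sym (negPf neq) scaler0.
Qed.

Lemma ext_linear_eq (f g : {linear ext R n -> ext R n}) :
  (forall S, f (ebase R S) = g (ebase R S)) -> f =1 g.
Proof.
move=> fg a; rewrite (ext_ebase_sum a) !linear_sum.
by apply: eq_bigr => S _; rewrite !linearZ /= fg.
Qed.

Lemma ext_wedge_ebase S T :
  ext_wedge (ebase R S) (ebase R T) = ext_wedge_base R S T.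
Proof.
rewrite /ext_wedge (bigD1 S) //= [X in _ + X]big1 ?addr0 => [|S' neq]; last first.
  by apply: big1 => T' _; rewrite ffunE (negPf neq) mul0r scale0r.
rewrite (bigD1 T) //= big1 ?addr0 => [|T' neq].
  by rewrite !ffunE !eqxx mulr1 scale1r.
by rewrite !ffunE (negPf neq) mulr0 scale0r.
Qed.

(** * Basis vectors acting on basis multivectors, and the Clifford relation *)

Lemma evec_wedge_ebase i S :
  ext_wedge (evec R i) (ebase R S) =
    if i \in S then 0 else insertion_sign i S *: ebase R (i |: S).
Proof.
rewrite ext_wedge_ebase /ext_wedge_base disjoints1 /inversions big_set1.
by case: (i \in S).
Qed.

Lemma contraction_ebase i S :
  ext_contraction (delta_mx 0 i) (ebase R S) =
    if i \in S then insertion_sign i S *: ebase R (S :\ i) else 0.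
Proof.
rewrite /ext_contraction (bigD1 i) //= [X in _ + X]big1 ?addr0 => [|j neq]; last first.
  by apply: big1 => T' _; rewrite mxE (negPf neq) mul0r scale0r.
rewrite (bigD1 S) //= big1 ?addr0 => [|T' neq]; last first.
  by rewrite !ffunE (negPf neq) mulr0 scale0r.
rewrite mxE ffunE !eqxx mulr1 scale1r /ext_contraction_base.
case: ifP => iS.
  rewrite (bigD1 i) //= eqxx mulr1 [X in _ + X]big1 ?addr0 // => j /andP[_ neq].
  by rewrite eq_sym (negPf neq) mulr0 scale0r.
apply: big1 => j jS; case: eqP => [e|_]; first by rewrite e jS in iS.
by rewrite mulr0 scale0r.
Qed.

Lemma insertion_signU1 i j S :
  j \notin S ->
  insertion_sign i (j |: S) = (-1) ^+ (j < i)%N * insertion_sign i S.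
Proof. by move=> jS; rewrite /insertion_sign big_setU1 //= exprD. Qed.

Lemma insertion_signD1 i j S :
  j \in S ->
  insertion_sign i S = (-1) ^+ (j < i)%N * insertion_sign i (S :\ j).
Proof. by move=> jS; rewrite /insertion_sign (big_setD1 j) //= exprD. Qed.

Lemma insertion_signK i S : insertion_sign i S * insertion_sign i S = 1.
Proof. by rewrite -expr2 sqrr_sign. Qed.

(** For [i = j] exactly one of the two orders of composition survives on [e_S], and its sign occurs
    squared. For distinct indices both orders vanish unless [j] is in [S] and [i] is not; then they
    give the same multivector with opposite signs. *)
Lemma contraction_wedge_ebase i j S :
  ext_contraction (delta_mx 0 j) (ext_wedge (evec R i) (ebase R S)) =
    (i == j)%:R *: ebase R S
    - ext_wedge (evec R i) (ext_contraction (delta_mx 0 j) (ebase R S)).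
Proof.
rewrite evec_wedge_ebase contraction_ebase.
have [<-{j}|neq] := eqVneq i j.
  rewrite scale1r; case: ifP => iS.
    rewrite !linear0 linearZ /= evec_wedge_ebase !inE eqxx /= finset.setD1K //.
    by rewrite scalerA (insertion_signD1 i iS) ltnn mul1r insertion_signK scale1r subrr.
  rewrite linear0 linearZ /= contraction_ebase setU11 finset.setU1K ?iS //.
  by rewrite insertion_signU1 ?iS // ltnn mul1r scalerA insertion_signK scale1r subr0.
rewrite scale0r sub0r.
case: ifP => iS; case: ifP => jS.
- by rewrite linearZ /= evec_wedge_ebase !inE neq iS linear0 scaler0 oppr0.
- by rewrite !linear0.
- rewrite !linearZ /= contraction_ebase evec_wedge_ebase !inE jS neq iS orbT /=.
  rewrite -scaleNr !scalerA insertion_signU1 ?iS // (insertion_signD1 i jS).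
  have -> : (i |: S) :\ j = i |: (S :\ j).
    by rewrite finset.setDUl; congr (_ :|: _); apply/finset.setDidPl; rewrite disjoints1 inE.
  (* Inserting [i] first costs an extra sign when [i < j], removing [j] first costs one when
     [j < i]. Exactly one of these holds, hence the relative minus sign. *)
  congr (_ *: _); move: neq; rewrite -val_eqE /=; case: ltngtP => //= _ _;
    rewrite ?expr0 ?expr1; ring.
- by rewrite !linear0 linearZ /= contraction_ebase !inE jS eq_sym (negPf neq) scaler0.
Qed.

Lemma contraction_wedge i j a :
  ext_contraction (delta_mx 0 j) (ext_wedge (evec R i) a) =
    (i == j)%:R *: a - ext_wedge (evec R i) (ext_contraction (delta_mx 0 j) a).
Proof.
pose f := ext_contraction (delta_mx 0 j) \o ext_wedge (evec R i).
pose g := ((i == j)%:R \*: @idfun (ext R n))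
          \- (ext_wedge (evec R i) \o ext_contraction (delta_mx 0 j)).
by apply: (@ext_linear_eq f g) => S; exact: contraction_wedge_ebase.
Qed.

(** * Products with 1-forms, scalars and 2-forms *)

Lemma ext_wedge_suml (I : Type) (r : seq I) (c : I -> R) (f : I -> ext R n) b :
  ext_wedge (\sum_(i <- r) c i *: f i) b = \sum_(i <- r) c i *: ext_wedge (f i) b.
Proof.
(* The linearity law with coefficient -1 and zero arguments reads as a difference of equal terms,
   which gives the value at 0. *)
have w0 : ext_wedge (0 : ext R n) b = 0.
  by have := ext_wedge_linear_l b (-1) 0 0; rewrite !scaleN1r oppr0 addr0 addNr.
elim: r => [|i r IH]; first by rewrite !big_nil.
by rewrite !big_cons ext_wedge_linear_l IH.
Qed.

Lemma contractionE v b :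
  ext_contraction v b = \sum_i v 0 i *: ext_contraction (delta_mx 0 i) b.
Proof.
rewrite {1}(row_sum_delta v).
elim: (index_enum _) => [|i r IH]; rewrite ?big_nil ?big_cons.
  by have := ext_contraction_linear_l b (-1) 0 0; rewrite !scaleN1r oppr0 addr0 addNr.
by rewrite ext_contraction_linear_l IH.
Qed.

Lemma form1_wedge v b : ext_wedge (form1 v) b = \sum_i v 0 i *: ext_wedge (evec R i) b.
Proof. exact: ext_wedge_suml. Qed.

(** Multiples of the empty product [ebase set0] are the scalars of the exterior algebra; the
    co-derivative of a 1-form is of this kind. *)
Lemma wedge_scalar (c : R) b : ext_wedge (c *: ebase R finset.set0) b = c *: b.
Proof.
have := ext_wedge_suml [:: tt] (fun=> c) (fun=> ebase R finset.set0) b.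
rewrite !big_seq1 => ->; congr (_ *: _).
apply: (@ext_linear_eq (ext_wedge (ebase R finset.set0)) idfun) => S /=.
rewrite ext_wedge_ebase /ext_wedge_base.
by rewrite finset.disjoints_subset finset.sub0set /inversions big_set0
  finset.set0U expr0 scale1r.
Qed.

Lemma contraction_evec i j :
  ext_contraction (delta_mx 0 j) (evec R i) = (i == j)%:R *: ebase R finset.set0.
Proof.
rewrite contraction_ebase inE eq_sym; case: eqP => [->|_]; last by rewrite scale0r.
by rewrite finset.setDv /insertion_sign big_set1 ltnn expr0.
Qed.

(** By the Clifford relation, [e_j] contracts [e_i /\ e_k] to [delta_ij e_k - delta_kj e_i]. The
    first term selects row [j] of [A], the second its column [j], which is row [j] of [A^T]. *)
Lemma contraction_form2 j (A : 'M[R]_n) :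
  ext_contraction (delta_mx 0 j) (form2 A) = form1 (row j (A - A^T)).
Proof.
pose F i k : ext R n := A i k *: ((i == j)%:R *: evec R k - (k == j)%:R *: evec R i).
have -> : ext_contraction (delta_mx 0 j) (form2 A) = \sum_i \sum_k F i k.
  rewrite linear_sum; apply: eq_bigr => i _; rewrite linear_sum.
  apply: eq_bigr => k _; rewrite linearZ /= contraction_wedge contraction_evec.
  rewrite linearZ /=; congr (_ *: (_ - _ *: _)).
  by rewrite ext_wedge_ebase /ext_wedge_base disjoint_sym
    finset.disjoints_subset finset.sub0set /inversions
    big_set1 big_set0 finset.setU0 expr0 scale1r.
rewrite /form1.
transitivity (\sum_k A j k *: evec R k - \sum_i A i j *: evec R i).
  rewrite /F; under eq_bigr do under eq_bigr do rewrite scalerBr !scalerA.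
  under eq_bigr do rewrite sumrB.
  rewrite sumrB; congr (_ - _).
    rewrite (bigD1 j) //= [X in _ + X]big1 ?addr0 => [|i /negPf->].
      by apply: eq_bigr => k _; rewrite eqxx mulr1.
    by apply: big1 => k _; rewrite mulr0 scale0r.
  apply: eq_bigr => i _; rewrite (bigD1 j) //= eqxx mulr1 big1 ?addr0 // => k /negPf->.
  by rewrite mulr0 scale0r.
by rewrite -sumrB; apply: eq_bigr => k _; rewrite !mxE scalerBl.
Qed.

(** * Differentiation of form-valued functions *)

Definition is_partial i (w : 'rV[R]_n -> ext R n) (x : 'rV[R]_n) (w' : ext R n) :=
  forall S, is_derive x (delta_mx 0 i) (fun y => w y S : R) (w' S).

(** [is_partial] carries derivability along with the value, so the rules below compose; this lemma
    then reads off [partial_form]. *)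
Lemma is_partialE i w x w' : is_partial i w x w' -> partial_form i w x = w'.
Proof. by move=> h; apply/ffunP => S; rewrite ffunE; case: (h S). Qed.

Lemma is_partial_cst i a x : is_partial i (fun=> a) x 0.
Proof. by move=> S; rewrite ffunE; exact: is_derive_cst. Qed.

Lemma is_partial_sum i (I : Type) (r : seq I) (w : I -> 'rV[R]_n -> ext R n) x w' :
  (forall k, is_partial i (w k) x (w' k)) ->
  is_partial i (fun y => \sum_(k <- r) w k y) x (\sum_(k <- r) w' k).
Proof.
move=> h S; rewrite sum_ffunE; under eq_fun do rewrite sum_ffunE.
by apply: is_derive_bigsum => k; exact: h.
Qed.

Lemma is_partialZ i (f : 'rV[R]_n -> R) w x (df : R) w' :
  is_derive x (delta_mx 0 i) f df -> is_partial i w x w' ->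
  is_partial i (fun y => f y *: w y) x (df *: w x + f x *: w').
Proof.
move=> hf hw S; rewrite !ffunE addrC; under eq_fun do rewrite ffunE.
rewrite [_ *: w x S]mulrC; exact: is_deriveM.
Qed.

(** In the basis expansion of [w], the form [L (w y)] is a sum of scalar coordinates times the
    constant forms [L e_S], so only the coordinates are differentiated. *)
Lemma is_partial_linear i (L : {linear ext R n -> ext R n}) w x w' :
  is_partial i w x w' -> is_partial i (fun y => L (w y)) x (L w').
Proof.
move=> h; rewrite (ext_ebase_sum w') linear_sum.
under eq_fun do rewrite (ext_ebase_sum (w _)) linear_sum.
apply: is_partial_sum => S; under eq_fun do rewrite linearZ.
rewrite linearZ /=.
have := is_partialZ (h S) (is_partial_cst i (L (ebase R S)) x).
by rewrite scaler0 addr0.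
Qed.

End ExteriorCalculus.

Theorem theorem2p8 (R : realType) (n : nat) (hn : (3 <= n)%N)
    (Omega : set 'rV[R]_n) (hOmega : is_domain Omega)
    (u : 'rV[R]_n -> 'rV[R]_n) (b : 'rV[R]_n -> 'M[R]_n)
    (hu : forall i : 'I_n, smooth_on Omega (fun x => u x 0 i))
    (hb : forall j k : 'I_n, smooth_on Omega (fun x => b x j k))
    (hanti : forall (x : 'rV[R]_n) (j k : 'I_n),
        Omega x -> b x k j = - b x j k) :
  let uF := fun x : 'rV[R]_n => form1 (u x) in
  let bF := fun x : 'rV[R]_n => form2 (b x) in
  forall x : 'rV[R]_n, Omega x ->
    ext_deriv (fun y => ext_contraction (u y) (bF y)) x
      + coderiv (fun y => ext_wedge (uF y) (bF y)) x
    = ext_wedge (coderiv uF x) (bF x)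
      - ext_wedge (uF x) (coderiv bF x)
      - ext_contraction (u x) (ext_deriv bF x)
      + form2 ((gradient u x + (gradient u x)^T) *m (b x - (b x)^T)).
Proof.
move=> uF bF x Ox.
set G := gradient u x.
pose E i : {linear ext R n -> ext R n} := ext_wedge (evec R i).
pose I i : {linear ext R n -> ext R n} := ext_contraction (delta_mx 0 i).
pose B := bF x; pose dB i := partial_form i bF x.
have EI i j a : I j (E i a) = (i == j)%:R *: a - E i (I j a).
  exact: contraction_wedge.
have hu' i j : is_derive x (delta_mx 0 i) (fun y => u y 0 j) (G i j).
  (* The empty word [[::]] selects the coordinate function itself. *)
  rewrite mxE; apply: derivableP; exact: (hu j [::] x Ox).2.
have hB i : is_partial i bF x (dB i).
  (* Any derivative must equal [dB i], so the witness may be left to unification with the sum and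
     product rules. *)
  suff [w' hw] : exists w', is_partial i bF x w' by rewrite /dB (is_partialE hw).
  eexists; apply: is_partial_sum => j; apply: is_partial_sum => k.
  apply: is_partialZ; last exact: is_partial_cst.
  apply: derivableP; exact: (hb j k [::] x Ox).2.
(* Contraction by [u] and exterior product by [u] both have the form [sum_j u_j L_j] with constant
   [L_j]; one Leibniz rule serves both, with [L := I] and [L := E]. *)
have hL (L : 'I_n -> {linear ext R n -> ext R n}) i :
    partial_form i (fun y => \sum_j u y 0 j *: L j (bF y)) x =
    \sum_j (G i j *: L j B + u x 0 j *: L j (dB i)).
  by apply/is_partialE/is_partial_sum => j; apply/is_partialZ/is_partial_linear.
have duF i : partial_form i uF x = \sum_j G i j *: evec R j.
  apply: is_partialE; apply: is_partial_sum => j.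
  by have := is_partialZ (hu' i j) (is_partial_cst i (evec R j) x); rewrite scaler0 addr0.
have dI i : partial_form i (fun y => ext_contraction (u y) (bF y)) x =
    \sum_j (G i j *: I j B + u x 0 j *: I j (dB i)).
  rewrite -(hL I i); congr partial_form; apply/funext => y; exact: contractionE.
have dE i : partial_form i (fun y => ext_wedge (uF y) (bF y)) x =
    \sum_j (G i j *: E j B + u x 0 j *: E j (dB i)).
  rewrite -(hL E i); congr partial_form; apply/funext => y; exact: form1_wedge.
have -> : ext_wedge (coderiv uF x) (bF x) = - \sum_i G i i *: B.
  (* Contracting [e_j] by [e_i] leaves [delta_ij] times the unit, so only the trace of [G]
     survives. *)
  have -> : coderiv uF x = (- \sum_i G i i) *: ebase R finset.set0.
    rewrite /coderiv scaleNr scaler_suml; congr (- _); apply: eq_bigr => i _.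
    rewrite duF linear_sum (bigD1 i) //= big1 ?addr0 => [|j /negPf neq].
      by rewrite linearZ /= contraction_evec eqxx scale1r.
    by rewrite linearZ /= contraction_evec neq scale0r scaler0.
  by rewrite wedge_scalar scaleNr scaler_suml.
(* The remaining products become double sums with coefficients [G i j] or [u_j], leaving only
   manipulations of [E] and [I]. *)
pose dsum (c : 'I_n -> 'I_n -> R) (f : 'I_n -> 'I_n -> ext R n) :=
  \sum_i \sum_j c i j *: f i j.
have dsumD c f g : dsum c (fun i j => f i j + g i j) = dsum c f + dsum c g.
  rewrite -big_split; apply: eq_bigr => i _; rewrite -big_split.
  by apply: eq_bigr => j _; rewrite scalerDr.
have dsumN c f : dsum c (fun i j => - f i j) = - dsum c f.
  rewrite -sumrN; apply: eq_bigr => i _; rewrite -sumrN.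
  by apply: eq_bigr => j _; rewrite scalerN.
have dsumdelta c f : dsum c (fun i j => (i == j)%:R *: f i) = \sum_i c i i *: f i.
  apply: eq_bigr => i _; rewrite (bigD1 i) //= [X in _ + X]big1 ?addr0.
    by rewrite eqxx scale1r.
  by move=> j /negPf neq; rewrite eq_sym neq scale0r scaler0.
have -> : form2 ((G + G^T) *m (b x - (b x)^T)) =
    dsum (fun i j => G i j) (fun i j => E i (I j B)) +
    dsum (fun i j => G i j) (fun i j => E j (I i B)).
  (* Swapping the indices turns the second sum into one of [G j i *: E i (I j B)], so the
     coefficients add up to [G + G^T]. *)
  rewrite [X in _ = _ + X]exchange_big -big_split; apply: eq_bigr => i _.
  rewrite -big_split /=.
  transitivity (\sum_j (G + G^T) i j *: E i (I j B)).
    (* [I j B] is the 1-form of row [j] of [b - b^T]; summing over [j] first produces the entries of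
       the matrix product. *)
    under [RHS]eq_bigr => j _.
      rewrite [I j B]contraction_form2 (linear_sum (E i)) scaler_sumr.
      under eq_bigr do rewrite linearZ scalerA.
      over.
    rewrite exchange_big; apply: eq_bigr => k _; rewrite -scaler_suml; congr (_ *: _).
    by rewrite mxE; apply: eq_bigr => j _; rewrite !mxE.
  by apply: eq_bigr => j _; rewrite -scalerDl !mxE.
have -> : ext_deriv (fun y => ext_contraction (u y) (bF y)) x =
    dsum (fun i j => G i j) (fun i j => E i (I j B)) +
    dsum (fun i j => u x 0 j) (fun i j => E i (I j (dB i))).
  rewrite -big_split; apply: eq_bigr => i _; rewrite dI (linear_sum (E i)) -big_split.
  by apply: eq_bigr => j _; rewrite (linearD (E i)) !(linearZ_LR (E i)).
have -> : coderiv (fun y => ext_wedge (uF y) (bF y)) x =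
    - (dsum (fun i j => G i j) (fun i j => I i (E j B)) +
       dsum (fun i j => u x 0 j) (fun i j => I i (E j (dB i)))).
  congr (- _); rewrite -big_split; apply: eq_bigr => i _.
  rewrite dE (linear_sum (I i)) -big_split.
  by apply: eq_bigr => j _; rewrite (linearD (I i)) !(linearZ_LR (I i)).
have -> : ext_wedge (uF x) (coderiv bF x) =
    - dsum (fun i j => u x 0 j) (fun i j => E j (I i (dB i))).
  rewrite form1_wedge [dsum _ _]exchange_big -sumrN; apply: eq_bigr => j _.
  rewrite (linearN (E j)) (linear_sum (E j)) scalerN; congr (- _).
  exact: scaler_sumr.
have -> : ext_contraction (u x) (ext_deriv bF x) =
    dsum (fun i j => u x 0 j) (fun i j => I j (E i (dB i))).
  rewrite contractionE [dsum _ _]exchange_big; apply: eq_bigr => j _.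
  by rewrite (linear_sum (I j)) scaler_sumr.
(* The Kronecker delta leaves the diagonal of [c]: the trace of [G] for the terms in [B], and
   [sum_i u_i d_i b] for those in [dB]. *)
have dsumIE c f : dsum c (fun i j => I i (E j (f i))) =
    \sum_i c i i *: f i - dsum c (fun i j => E j (I i (f i))).
  rewrite -dsumdelta -dsumN -dsumD; apply: eq_bigr => i _; apply: eq_bigr => j _.
  by rewrite EI [j == i]eq_sym.
(* Here the contraction has index [j] and the exterior product index [i], the reverse of [dsumIE];
   the diagonal sum is again [sum_i u_i d_i b]. *)
have -> : dsum (fun i j => u x 0 j) (fun i j => I j (E i (dB i))) =
    \sum_i u x 0 i *: dB i - dsum (fun i j => u x 0 j) (fun i j => E i (I j (dB i))).
  rewrite -(dsumdelta (fun i j => u x 0 j)) -dsumN -dsumD.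
  by apply: eq_bigr => i _; apply: eq_bigr => j _; rewrite EI.
rewrite (dsumIE _ (fun=> B)) (dsumIE _ dB).
(* Both sides are now the same signed combination of normally ordered sums, compared coordinate by
   coordinate. *)
by apply/ffunP => S; rewrite !ffunE; ring.
Qed.
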